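(* Let $X=(x_1,x_2)$ be two distinct real points, let $w=(w_1,w_2)$ be weights with $w_1,w_2>0$ and $w_1+w_2=1$, let $\sigma$ be the segment with endpoints $x_1,x_2$, so that $\operatorname{vol}(\sigma)=|x_1-x_2|$, and put $\rho=w_1/w_2$. Let $y=(y_1,y_2)$ be the optimal height vector (tent pole heights) of the log-concave maximum likelihood problem for $(X,w)$. If $y_1\neq y_2$, then $$y_1=\log\bigl(w_1\,W(\rho+1;-\rho^{-1}-1;-\rho)+w_1+w_2\bigr)-\log(\operatorname{vol}(\sigma)),$$ $$y_2=\log\bigl(-w_2\,W(\rho+1;-\rho^{-1}-1;-\rho)+w_1+w_2\bigr)-\log(\operatorname{vol}(\sigma)),$$ where $W(\rho+1;-\rho^{-1}-1;-\rho)$ is a value (the same in both formulas) of the multi-valued generalized Lambert $W$ function. Otherwise $y=(-\log(\operatorname{vol}(\sigma)),-\log(\operatorname{vol}(\sigma)))$.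
   Context: Generalized $W$-Lambert function: for real numbers $t,s,a$, a value of the (multi-valued) function $W(t;s;a)$ is a real number $x\neq s$ with $\exp(x)\,\dfrac{x-t}{x-s}=a$; that is, $W(t;s;\cdot)$ is the multi-valued inverse of $x\mapsto e^x\frac{x-t}{x-s}$. Optimal height vector: for $y\in\mathbb{R}^2$ let $h_{X,y}$ be the tent function, which here is the affine function on the segment $\sigma$ with $h_{X,y}(x_i)=y_i$ for $i=1,2$, and $-\infty$ outside $\sigma$. The log-concave maximum likelihood problem is to maximize $w_1\log f(x_1)+w_2\log f(x_2)$ over all probability densities $f$ on $\mathbb{R}$ with $\log f$ concave; its solution is $f=\exp(h_{X,y})$, where $y$ (the optimal height vector) is the maximizer over $y\in\mathbb{R}^2$ of $w\cdot y-\int_{\sigma}\exp(h_{X,y}(t))\,dt$. *)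

(* Defs.v *)
From HB Require Import structures.
From mathcomp Require Import all_boot all_order all_algebra.
From mathcomp Require Import all_classical all_reals all_analysis.
Set Implicit Arguments.
Unset Strict Implicit.
Unset Printing Implicit Defensive.
Import Order.TTheory GRing.Theory Num.Theory.
Import numFieldNormedType.Exports.
Local Open Scope classical_set_scope.
Local Open Scope ring_scope.

Definition genLambertW (R : realType) (t s a : R) : set R :=
  [set x | x != s /\ expR x * ((x - t) / (x - s)) = a].

(* The points are not assumed to be ordered. *)
Definition segment (R : realType) (x1 x2 : R) : set R :=
  [set` `[Num.min x1 x2, Num.max x1 x2]].

Definition vol (R : realType) (A : set R) : R := fine (lebesgue_measure A).

Definition tent (R : realType) (x1 x2 y1 y2 : R) (t : R) : \bar R :=
  if t \in segment x1 x2 then (y1 + (y2 - y1) * ((t - x1) / (x2 - x1)))%:E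
  else -oo%E.

Definition objective (R : realType) (x1 x2 w1 w2 y1 y2 : R) : \bar R :=
  ((w1 * y1 + w2 * y2)%:E
   - \int[lebesgue_measure]_(t in segment x1 x2) expeR (tent x1 x2 y1 y2 t))%E.

Definition optimal_height_vector (R : realType) (x1 x2 w1 w2 y1 y2 : R) : Prop :=
  forall z1 z2 : R,
    (objective x1 x2 w1 w2 z1 z2 <= objective x1 x2 w1 w2 y1 y2)%E.

Lemma vol_segment (R : realType) (x1 x2 : R) :
  vol (segment x1 x2) = `|x1 - x2|.
Proof.
rewrite /vol /segment lebesgue_measure_itv /= lte_fin.
have [le12|lt21] := leP x1 x2.
- rewrite ler0_norm ?subr_le0 // opprB.
  by case: ltgtP le12 => // -> _; rewrite subrr.
- by rewrite lt21 /= gtr0_norm // subr_gt0.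
Qed.

Lemma tent_x1 (R : realType) (x1 x2 y1 y2 : R) :
  tent x1 x2 y1 y2 x1 = y1%:E.
Proof.
rewrite /tent mem_set; first by rewrite subrr mul0r mulr0 addr0.
by rewrite /segment /= in_itv /= ge_min le_max lexx.
Qed.

Lemma tent_x2 (R : realType) (x1 x2 y1 y2 : R) :
  x1 != x2 -> tent x1 x2 y1 y2 x2 = y2%:E.
Proof.
move=> x12; rewrite /tent mem_set.
  by rewrite divff ?subr_eq0 1?eq_sym // mulr1 addrC subrK.
by rewrite /segment /= in_itv /= ge_min le_max lexx !orbT.
Qed.

(* Main.v *)
Require Import Defs.
From HB Require Import structures.
From mathcomp Require Import all_boot all_order all_algebra.
From mathcomp Require Import all_classical all_reals all_analysis.
From mathcomp Require Import ring lra.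
Import Order.TTheory GRing.Theory Num.Theory.
Import numFieldNormedType.Exports.
Local Open Scope classical_set_scope.
Local Open Scope ring_scope.

(** Write [L] for the length of the segment and [d] for [y1 - y2]. The mass of
the tent density with heights [y1] and [y2] is [L] times the logarithmic mean
of [exp y1] and [exp y2] ([integral_tent]), so the objective is an explicit
function of two real variables ([objectiveE]). Two one-parameter variations of
an optimal height vector are enough.

Shifting both heights by the same amount shows that the mass is [1]
([optimal_mass1]). When the heights are equal this reads [L exp y1 = 1], and
the flat case is done. When they differ it reads [L (exp y1 - exp y2) = d].

Moving only [y1] gives the stationarity equation [L exp y1 = 1 + w1 d]
([optimal_stationary]); subtracting, [L exp y2 = 1 - w2 d]. These are the two
formulas for the heights with [d] in the role of the Lambert value, and the
quotient of the two equations, [exp d = (1 + w1 d) / (1 - w2 d)], is the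
equation that defines that value. *)

(** The logarithmic mean of [exp y1] and [exp y2]: the average of the
exponential over the interval between [y1] and [y2], hence also the average of
[exp] of an affine function with end values [y1] and [y2]. *)
Definition expR_mean {R : realType} (y1 y2 : R) : R :=
  if y1 == y2 then expR y1 else (expR y1 - expR y2) / (y1 - y2).

Lemma expR_mean_gt0 {R : realType} {y1 y2 : R} : 0 < expR_mean y1 y2.
Proof.
rewrite /expR_mean; case: eqVneq => [_|]; first exact: expR_gt0.
rewrite neq_lt => /orP[lt12|lt21].
  by rewrite -mulrNN -invrN !opprB divr_gt0 ?subr_gt0 ?ltr_expR.
by rewrite divr_gt0 ?subr_gt0 ?ltr_expR.
Qed.

(** The mean is homogeneous in the two exponentials; this turns a common shift
of both heights into a rescaling of the mass. *)
Lemma expR_meanD {R : realType} {y1 y2 c : R} :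
  expR_mean (y1 + c) (y2 + c) = expR c * expR_mean y1 y2.
Proof.
rewrite /expR_mean (inj_eq (addIr c)); case: eqVneq => _.
  by rewrite expRD mulrC.
by rewrite !expRD opprD addrACA subrr addr0 -mulrBl mulrCA mulrA mulrC mulrA.
Qed.

Lemma integral_expR_affine {R : realType} {a b m k : R} : a < b -> k != 0 ->
  (\int[lebesgue_measure]_(t in `[a, b]) (expR (m + k * t))%:E
   = ((expR (m + k * b) - expR (m + k * a)) / k)%:E)%E.
Proof.
move=> ab k0.
pose F (t : R) : R := k^-1 * expR (m + k * t).
have dF (t : R) : is_derive t 1 F (expR (m + k * t)).
  apply: is_derive_eq.
  by rewrite /GRing.scale/= add0r mulr1; field.
have dF1 (t : R) : derivable F t 1 by exact: ex_derive.
have cF : continuous F.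
  by move=> t; apply: differentiable_continuous; exact/derivable1_diffP.
rewrite (@continuous_FTC2 _ _ F) //.
- by rewrite -EFinB /F; congr EFin; rewrite mulrBl ![_ * k^-1]mulrC.
- apply: continuous_subspaceT => t.
  apply: (@continuous_comp _ _ _ (fun u => m + k * u) expR); last exact: continuous_expR.
  by apply: cvgD; [exact: cvg_cst|apply: cvgM; [exact: cvg_cst|exact: cvg_id]].
- split; first by move=> t _; exact: dF1.
  + exact/cvg_at_right_filter/cF.
  + exact/cvg_at_left_filter/cF.
- by move=> t _; rewrite derive1E; exact: derive_val.
Qed.

(** Written as length times logarithmic mean, the mass of a tent density no
longer depends on the order of [x1] and [x2], nor on whether the tent is
flat. *)
Lemma integral_tent {R : realType} {x1 x2 y1 y2 : R} : x1 != x2 ->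
  (\int[lebesgue_measure]_(t in segment x1 x2) expeR (tent x1 x2 y1 y2 t)
   = (vol (segment x1 x2) * expR_mean y1 y2)%:E)%E.
Proof.
move=> x12; rewrite vol_segment.
pose k := (y2 - y1) / (x2 - x1).
have x21_neq0 : x2 - x1 != 0 by rewrite subr_eq0 eq_sym.
have tentE : {in segment x1 x2, forall t : R,
    expeR (tent x1 x2 y1 y2 t) = (expR ((y1 - k * x1) + k * t))%:E}.
  by move=> t xt; rewrite /tent xt /=; congr (expR _)%:E; rewrite /k; field.
transitivity (\int[lebesgue_measure]_(t in segment x1 x2)
    (expR ((y1 - k * x1) + k * t))%:E)%E; first exact: eq_integral.
rewrite /expR_mean; case: eqVneq => [y12|y12].
  have k0 : k = 0 by rewrite /k y12 subrr mul0r.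
  under eq_integral do rewrite k0 !mul0r subr0 addr0.
  rewrite /segment integral_cst; last exact: measurable_itv.
  have volE := vol_segment x1 x2; rewrite /vol /segment in volE.
  rewrite -volE EFinM muleC fineK //.
  by rewrite ge0_fin_numE // lebesgue_measure_itv /=; case: ifP => _; rewrite ltry.
have y21_neq0 : y2 - y1 != 0 by rewrite subr_eq0 eq_sym.
have y12_neq0 : y1 - y2 != 0 by rewrite subr_eq0.
have k_neq0 : k != 0 by rewrite mulf_neq0 ?invr_neq0.
have k1 : y1 - k * x1 + k * x1 = y1 by rewrite subrK.
have k2 : y1 - k * x1 + k * x2 = y2 by rewrite /k; field.
rewrite /segment; case: (ltgtP x1 x2) x12 => // lt_x _.
  rewrite integral_expR_affine // k1 k2 /k.
  rewrite ltr0_norm ?subr_lt0 //; congr EFin; field.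
  by rewrite y12_neq0 y21_neq0 x21_neq0.
rewrite integral_expR_affine // k1 k2 /k.
rewrite gtr0_norm ?subr_gt0 //; congr EFin; field.
by rewrite y12_neq0 y21_neq0 x21_neq0.
Qed.

Lemma objectiveE {R : realType} {x1 x2 w1 w2 y1 y2 : R} : x1 != x2 ->
  objective x1 x2 w1 w2 y1 y2
  = (w1 * y1 + w2 * y2 - vol (segment x1 x2) * expR_mean y1 y2)%:E.
Proof. by move=> x12; rewrite /objective integral_tent // -EFinB. Qed.

Lemma vol_segment_gt0 {R : realType} {x1 x2 : R} : x1 != x2 ->
  0 < vol (segment x1 x2).
Proof. by move=> x12; rewrite vol_segment normr_gt0 subr_eq0. Qed.

(** The graph of [ln] lies strictly below its tangent at [1], except at [1]
itself. *)
Lemma eq1_of_le_ln {R : realType} {m : R} : 0 < m -> m - 1 <= ln m -> m = 1.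
Proof.
move=> m_gt0 le_m; have [ln0|ln_neq0] := eqVneq (ln m) 0.
  by rewrite -[LHS]lnK ?posrE // ln0 expR0.
have := expR_gt1Dx ln_neq0; rewrite lnK ?posrE // => lt_m; lra.
Qed.

(** An optimal tent function is a probability density: as the weights sum to
[1], adding [c] to both heights adds [c] to the linear part of the objective
and multiplies the mass by [exp c]. Comparing the optimum with
[c := - ln mass], the shift that normalises the mass, gives
[mass - 1 <= ln mass]. *)
Lemma optimal_mass1 {R : realType} {x1 x2 w1 w2 y1 y2 : R} :
  x1 != x2 -> w1 + w2 = 1 -> optimal_height_vector x1 x2 w1 w2 y1 y2 ->
  vol (segment x1 x2) * expR_mean y1 y2 = 1.
Proof.
move=> x12 w12 y_opt.
have := y_opt (y1 - ln (vol (segment x1 x2) * expR_mean y1 y2))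
              (y2 - ln (vol (segment x1 x2) * expR_mean y1 y2)).
rewrite !objectiveE // lee_fin expR_meanD mulrCA.
have : 0 < vol (segment x1 x2) * expR_mean y1 y2.
  by rewrite mulr_gt0 ?vol_segment_gt0 ?expR_mean_gt0.
move: (_ * _) => mass mass_gt0.
rewrite expRN lnK ?posrE // mulVf ?gt_eqF // => le_mass.
apply: eq1_of_le_ln => //.
have shiftE : w1 * (y1 - ln mass) + w2 * (y2 - ln mass)
            = w1 * y1 + w2 * y2 - ln mass.
  by rewrite (_ : w2 = 1 - w1); [ring|lra].
by rewrite shiftE in le_mass; lra.
Qed.

(** Stationarity in the first height alone. Once the mass is [1], this equation
and the mass equation determine both exponentials as affine functions of
[y1 - y2]. *)
Lemma optimal_stationary {R : realType} {x1 x2 w1 w2 y1 y2 : R} :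
  x1 != x2 -> w1 + w2 = 1 -> optimal_height_vector x1 x2 w1 w2 y1 y2 ->
  y1 != y2 -> vol (segment x1 x2) * expR y1 = 1 + w1 * (y1 - y2).
Proof.
move=> x12 w12 y_opt y12; set L := vol _; set d := y1 - y2.
have d_neq0 : d != 0 by rewrite subr_eq0.
have mass1 := optimal_mass1 x12 w12 y_opt.
have AB : L * (expR y1 - expR y2) = d.
  by move: mass1; rewrite /expR_mean (negbTE y12) mulrA -/L -/d => /divr1_eq.
(* Optimality says that the mass at (y1 + h, y2) is at least 1 + w1 * h.
   Multiplying this by d * (d + h), which is positive for `|h| < `|d|, clears
   the denominator d + h whatever the sign of d; f is the resulting difference,
   so it is maximal, with value 0, at h = 0. *)
pose f (h : R) : R :=
  d * ((1 + w1 * h) * (d + h) - L * (expR (y1 + h) - expR y2)).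
have df (h : R) : is_derive h 1 f
    (d * (w1 * (d + h) + (1 + w1 * h) - L * expR (y1 + h))).
  apply: is_derive_eq.
  by rewrite /GRing.scale/=; ring.
have f_le (h : R) : h \in `]- `|d|, `|d|[ -> f h <= f 0.
  rewrite in_itv /= => /andP[lo hi].
  have -> : f 0 = 0 by rewrite /f !addr0 mulr0 addr0 mul1r AB subrr mulr0.
  have ddh : 0 < d * (d + h).
    move: lo hi; case: (ltgtP d 0) d_neq0 => // d0 _.
      by rewrite ltr0_norm // => lo hi; nra.
    by rewrite gtr0_norm // => lo hi; nra.
  have dh_neq0 : d + h != 0 by apply: contraTneq ddh => ->; rewrite mulr0 ltxx.
  have := y_opt (y1 + h) y2; rewrite !objectiveE // lee_fin mass1 -/L.
  have dhE : y1 + h - y2 = d + h by rewrite /d; ring.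
  rewrite /expR_mean -subr_eq0 dhE (negbTE dh_neq0).
  set q := (_ - _) / _ => le_q.
  have qE : expR (y1 + h) - expR y2 = q * (d + h) by rewrite /q divfK.
  rewrite /f qE.
  have -> : d * ((1 + w1 * h) * (d + h) - L * (q * (d + h)))
          = d * (d + h) * (1 + w1 * h - L * q) by ring.
  rewrite pmulr_rle0 //; lra.
have f'0 : is_derive (0 : R) 1 f 0.
  apply: (@derive1_at_max _ f (- `|d|) `|d| 0) => //.
  - by rewrite ge0_cp.
  - by rewrite in_itv /= oppr_lt0 normr_gt0 d_neq0.
have := @derive_val _ _ _ _ _ _ _ f'0.
rewrite (@derive_val _ _ _ _ _ _ _ (df 0)) => /eqP.
rewrite mulf_eq0 (negbTE d_neq0) /= !addr0 mulr0 addr0 => /eqP stat; lra.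
Qed.

Theorem proposition3p9 (R : realType) (x1 x2 w1 w2 y1 y2 : R)
  (x1x2 : x1 != x2) (w1_gt0 : 0 < w1) (w2_gt0 : 0 < w2) (w1w2 : w1 + w2 = 1)
  (y_opt : optimal_height_vector x1 x2 w1 w2 y1 y2) :
  let sigma := segment x1 x2 in
  let rho := w1 / w2 in
  (y1 != y2 ->
     exists2 W : R, genLambertW (rho + 1) (- rho^-1 - 1) (- rho) W &
       [/\ 0 < w1 * W + w1 + w2,
           0 < - w2 * W + w1 + w2,
           y1 = ln (w1 * W + w1 + w2) - ln (vol sigma)
         & y2 = ln (- w2 * W + w1 + w2) - ln (vol sigma)]) /\
  (y1 = y2 -> (y1, y2) = (- ln (vol sigma), - ln (vol sigma))).
Proof.
move=> sigma rho.
have L_gt0 : 0 < vol sigma by exact: vol_segment_gt0.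
have mass1 := optimal_mass1 x1x2 w1w2 y_opt.
have heightE (y : R) : y = ln (vol sigma * expR y) - ln (vol sigma).
  by rewrite lnM ?posrE ?expR_gt0 // expRK addrAC subrr add0r.
split=> [y12|y12]; last first.
  rewrite -y12 (_ : y1 = - ln (vol sigma)) // [LHS]heightE.
  by move: mass1; rewrite /expR_mean y12 eqxx => ->; rewrite ln1 add0r.
have A_E := optimal_stationary x1x2 w1w2 y_opt y12.
have d_neq0 : y1 - y2 != 0 by rewrite subr_eq0.
have AB : vol sigma * (expR y1 - expR y2) = y1 - y2.
  by move: mass1; rewrite /expR_mean (negbTE y12) mulrA => /divr1_eq.
rewrite -/sigma in A_E.
have A_W : w1 * (y1 - y2) + w1 + w2 = vol sigma * expR y1 by lra.
have B_W : - w2 * (y1 - y2) + w1 + w2 = vol sigma * expR y2.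
  rewrite (_ : w2 = 1 - w1); lra.
have A_gt0 : 0 < vol sigma * expR y1 by rewrite mulr_gt0 ?expR_gt0.
have B_gt0 : 0 < vol sigma * expR y2 by rewrite mulr_gt0 ?expR_gt0.
have w1_neq0 : w1 != 0 by rewrite gt_eqF.
have w2_neq0 : w2 != 0 by rewrite gt_eqF.
exists (y1 - y2); last by rewrite A_W B_W -!heightE.
(* Since w1 + w2 = 1, the two parameters of the Lambert function are 1 / w2 and
   -1 / w1, the zeros of the affine expressions for L exp y2 and L exp y1 in
   terms of y1 - y2. *)
have rhoV : - rho^-1 - 1 = - w1^-1.
  by rewrite /rho invf_div -[in RHS](mul1r w1^-1) -[in RHS]w1w2; field.
have rho1 : rho + 1 = w2^-1.
  by rewrite /rho -[in RHS](mul1r w2^-1) -[in RHS]w1w2; field.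
have denE : y1 - y2 - - w1^-1 = w1^-1 * (vol sigma * expR y1).
  by rewrite A_E; field.
have numE : y1 - y2 - w2^-1 = - (w2^-1 * (vol sigma * expR y2)).
  have -> : vol sigma * expR y2 = 1 - w2 * (y1 - y2) by rewrite -B_W; lra.
  by field.
have L_neq0 : vol sigma != 0 by rewrite gt_eqF.
have e1_neq0 : expR y1 != 0 by rewrite gt_eqF ?expR_gt0.
have e2_neq0 : expR y2 != 0 by rewrite gt_eqF ?expR_gt0.
rewrite /genLambertW /= rhoV rho1; split.
  by rewrite -subr_eq0 denE !mulf_neq0 ?invr_neq0.
rewrite denE numE expRB /rho; field.
by rewrite L_neq0 w1_neq0 w2_neq0 e1_neq0 e2_neq0.
Qed.
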